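(* Assume weak monotonicity of $M$ in $D$: for all $z\in\{0,1\}$, $\Pr(M_{1,z}\ge M_{0,z})=1$; and weak monotonicity of $M$ in $Z$: for all $d\in\{0,1\}$, $\Pr(M_{d,1}\ge M_{d,0})=1$. Even when both assumptions are satisfied, $NIE_0^{IV}$ identifies a different quantity from $NIE_0$ (the two do not necessarily coincide): $$NIE_0=\sum_{z\in\{0,1\}}\mathbf{E}[Y_{01}-Y_{00}\mid M_{1z}>M_{0z}]\Pr(M_{1z}>M_{0z})\Pr(Z=z),$$ while $$NIE_0^{IV}=\mathbf{E}[Y_{01}-Y_{00}\mid M_{01}>M_{00}]\sum_{z\in\{0,1\}}\Pr(M_{1z}>M_{0z})\Pr(Z=z).$$
   Context: Setting. For each individual in a random sample, $D\in\{0,1\}$ is a treatment, $M\in\{0,1\}$ an observed mediator, $Y\in\mathbb{R}$ an observed outcome and $Z\in\{0,1\}$ a binary instrument. Covariates are suppressed and everything is implicitly conditional on them. Effects may be heterogeneous across individuals. $Y_{d,m}$ (also written $Y_{dm}$) is the potential outcome when the treatment is set to $d$ and the mediator to $m$. $Y_{d,m,z}$ is the potential outcome when in addition the instrument is set to $z$. $M_{d,z}$ (also written $M_{dz}$) is the potential mediator when the treatment is set to $d$ and the instrument to $z$, and $M_d=M_{d,Z}$. $Y_{d,M_{d',z}}$ is the potential outcome when the treatment is set to $d$ and the mediator to the value $M_{d',z}$; similarly for $Y_{d,M_{d'}}=Y_{d,M_{d',Z}}$. The observed variables satisfy $M=M_{D,Z}$ and $Y=Y_{D,M_D}$. Assumptions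 ($\perp\!\!\!\perp$ denotes mean independence). Treatment exogeneity: for all $d,d',m$, $\{Y_{d,m},M_{d'}\}\perp\!\!\!\perp D$. Binary instrument: for all $d,d',m,z$, (i) randomization: $\{Y_{d,m},M_{d',z},D\}\perp\!\!\!\perp Z$; (ii) exclusion restriction: $Y_{d,m,z}=Y_{d,m}$; (iii) relevance: $\Pr(M|Z=z)$ is a nontrivial function of $z$. IV coefficients. Postulate the (possibly misspecified) linear model $Y=D(\alpha_0+\alpha_1M)+(1-D)(\beta_0+\beta_1M)+u$, $M=D(\pi_0+\pi_1Z)+(1-D)(\tau_0+\tau_1Z)+v$, with $\mathbf{E}[u|D,Z]=\mathbf{E}[v|D,Z]=0$. The coefficients $\alpha,\beta$ are estimated by the IV regression of $Y$ on $M$ using $Z$ as instrument, separately for each value of $D$, that is, from the moment conditions $\mathbf{E}[Du]=\mathbf{E}[DZu]=0$ and $\mathbf{E}[(1-D)u]=\mathbf{E}[(1-D)Zu]=0$. The coefficients $\pi,\tau$ are those of the regression of $M$ on $Z$ separately for each value of $D$. The superscript $IV$ denotes the probability limit of the resulting estimator. IV estimand: $NIE_0^{IV}=\beta_1^{IV}\big(\pi_0^{IV}-\tau_0^{IV}+(\pi_1^{IV}-\tau_1^{IV})\mathbf{E}[Z]\big)$. Target parameter (natural indirect effect): $NIE_0=\mathbf{E}[Y_{0,M_{1,Z}}-Y_{0,M_{0,Z}}]=\sum_{z\in\{0,1\}}\mathbf{E}[Y_{0,M_{1,z}}-Y_{0,M_{0,z}}]\Pr(Z=z)$.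
   Formalization: Treatment exogeneity is assumed for $M_{d',z}$ at each $z$, not only for $M_{d'}=M_{d',Z}$, since the IV formula fails otherwise; independence is joint, $Y_{d,m}$ integrable, and $D=d$, $Z=z$, $M_{01}>M_{00}$ have positive probability. *)

(* Defs.v *)
From HB Require Import structures.
From mathcomp Require Import all_boot all_order all_algebra.
From mathcomp Require Import all_classical all_reals all_analysis.

Set Implicit Arguments.
Unset Strict Implicit.
Unset Printing Implicit Defensive.

Import Order.TTheory GRing.Theory Num.Theory.
Import numFieldNormedType.Exports.

Local Open Scope classical_set_scope.
Local Open Scope ring_scope.

Section probability_vocabulary.
Context {d : measure_display} {T : measurableType d} {R : realType}.
Variable P : probability T R.

Definition pr (A : set T) : R := fine (P A).

Definition mean (X : T -> R) : R := fine 'E_P[X].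

(* Conditional probability and mean are 0 when the conditioning event has
   probability 0. *)
Definition cond_pr (A B : set T) : R := pr (A `&` B) / pr B.

Definition cond_mean (X : T -> R) (A : set T) : R :=
  (\int[P]_(t in A) X t) / pr A.

(* Mean independence of the vector {Y, V} from the binary W, for a real Y and
   a V with finitely many values (here K is bool or bool * bool). The mean of
   every function of the vector that is affine in Y is unaffected by
   conditioning on W. This is joint in (Y, V), hence implies that E[Y], E[V] and
   E[Y V] are unaffected, but it is weaker than stochastic independence since
   only the mean of Y is restricted. *)
Definition mean_indep (Y : T -> R) (K : Type) (V : T -> K) (W : T -> bool) :
    Prop :=
  forall (f : K -> R) (w : bool),
    cond_mean (fun t => f (V t)) [set t | W t = w] = mean (fun t => f (V t))
    /\ cond_mean (fun t => Y t * f (V t)) [set t | W t = w]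
       = mean (fun t => Y t * f (V t)).

End probability_vocabulary.

Section random_sample.
Context {d : measure_display} {T : measurableType d} {R : realType}.

Definition tuple_cons n (p : T * n.-tuple T) : n.+1.-tuple T :=
  [tuple of p.1 :: p.2].

Lemma measurable_tuple_cons n :
  measurable_fun [set: T * n.-tuple T] (@tuple_cons n).
Proof. by apply: measurable_cons. Qed.

HB.instance Definition _ n := isMeasurableFun.Build _ _ _ _
  (@tuple_cons n) (@measurable_tuple_cons n).

(* The law of a random sample of n individuals: the n-fold product of P. *)
Fixpoint sample_law (P : probability T R) (n : nat) :
    probability (n.-tuple T) R :=
  match n with
  | 0 => \d_([tuple] : 0.-tuple T)
  | n'.+1 => distribution (P \x sample_law P n')%E (@tuple_cons n')
  end.

(* An estimator is a statistic of samples of every size. *)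
Definition estimator := forall n, n.-tuple T -> R.

Definition cvg_in_probability (P : probability T R) (X : estimator) (c : R) :
    Prop :=
  forall e : R, 0 < e ->
    (sample_law P n [set s | e <= `|X n s - c|]) @[n --> \oo] --> 0%E.

(* Probability limit; 0 when there is none. *)
Definition plim (P : probability T R) (X : estimator) : R :=
  xget 0 [set c | cvg_in_probability P X c].

(* Solutions c = (intercept, slope) of the sample moment conditions
     sum_i 1{D_i = g} e_i = sum_i 1{D_i = g} W_i e_i = 0,
     e_i = Y_i - c.1 - c.2 X_i,
   i.e. of the IV regression of Y on X with instrument W in the subsample
   D = g. For W = X these are the normal equations of the OLS regression. *)
Definition iv_moments (D : T -> bool) (g : bool) (Y X W : T -> R) (s : seq T) :
    set (R * R) :=
  [set c | \sum_(t <- s | D t == g) (Y t - (c.1 + c.2 * X t)) = 0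
        /\ \sum_(t <- s | D t == g) W t * (Y t - (c.1 + c.2 * X t)) = 0].

(* The IV coefficients, set to (0, 0) on the samples for which the moment
   conditions do not have exactly one solution. *)
Definition iv_coef (D : T -> bool) (g : bool) (Y X W : T -> R) (s : seq T) :
    R * R :=
  xget (0, 0) [set c | iv_moments D g Y X W s = [set c]].

End random_sample.

Arguments estimator {d} T R.

Section mediation.
Context {d : measure_display} {T : measurableType d} {R : realType}.

(* A point of T is an individual. *)
Record mediation_model (P : probability T R) := MediationModel {
  D_ : {RV P >-> bool};
  Z_ : {RV P >-> bool};
  Mpot : bool -> bool -> {RV P >-> bool};              (* M_{d,z} *)
  Ypot : bool -> bool -> {RV P >-> R};                 (* Y_{d,m} *)
  Ypotz : bool -> bool -> bool -> {RV P >-> R}         (* Y_{d,m,z} *)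
}.

Context {P : probability T R}.
Variable mod : mediation_model P.

Let D : T -> bool := D_ mod.
Let Z : T -> bool := Z_ mod.
Let M (d z : bool) : T -> bool := Mpot mod d z.
Let Y (d m : bool) : T -> R := Ypot mod d m.

Definition Mobs (t : T) : bool := M (D t) (Z t) t.
Definition Yobs (t : T) : R := Y (D t) (Mobs t) t.

(* Exogeneity bears on the potential mediator at each instrument value. The
   version for M_{d',Z} only constrains averages over Z of the M_{d',z}; it is
   implied by this one together with iv_randomization. *)
Definition treatment_exogeneity : Prop :=
  forall d d' m z : bool, mean_indep P (Y d m) (M d' z) D.

Definition iv_randomization : Prop :=
  forall d d' m z : bool, mean_indep P (Y d m) (fun t => (M d' z t, D t)) Z.

Definition iv_exclusion : Prop :=
  forall (d m z : bool) (t : T), Ypotz mod d m z t = Y d m t.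

Definition iv_relevance : Prop :=
  cond_pr P [set t | Mobs t = true] [set t | Z t = true]
  <> cond_pr P [set t | Mobs t = true] [set t | Z t = false].

Definition monotone_in_D : Prop :=
  forall z : bool, pr P [set t | (M true z t >= M false z t)%N] = 1.

Definition monotone_in_Z : Prop :=
  forall d : bool, pr P [set t | (M d true t >= M d false t)%N] = 1.

(* What the expressions in the statement need in order to be defined: finite
   means, conditioning events D = d, Z = z and M_{01} > M_{00} of positive
   probability. Relevance gives M_{d1} > M_{d0} positive probability for some d
   only, while the IV regression in the subsample D = 0 needs it for d = 0. *)
Record well_defined : Prop := WellDefined {
  wd_integrable : forall d m : bool,
    P.-integrable [set: T] (fun t => (Y d m t)%:E);
  wd_treatment : forall d : bool, 0 < pr P [set t | D t = d];
  wd_instrument : forall z : bool, 0 < pr P [set t | Z t = z];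
  wd_compliers : 0 < pr P [set t | (M false true t > M false false t)%N]
}.

Record assumptions : Prop := Assumptions {
  as_well_defined : well_defined;
  as_exogeneity : treatment_exogeneity;
  as_randomization : iv_randomization;
  as_exclusion : iv_exclusion;
  as_relevance : iv_relevance;
  as_monotone_in_D : monotone_in_D;
  as_monotone_in_Z : monotone_in_Z
}.

Definition NIE0 : R :=
  mean P (fun t => Y false (M true (Z t) t) t - Y false (M false (Z t) t) t).

Let Zr (t : T) : R := (Z t)%:R.
Let Mr (t : T) : R := (Mobs t)%:R.

Definition beta_hat (s : seq T) : R * R := iv_coef D false Yobs Mr Zr s.
Definition pi_hat (s : seq T) : R * R := iv_coef D true Mr Zr Zr s.
Definition tau_hat (s : seq T) : R * R := iv_coef D false Mr Zr Zr s.

Definition beta1_IV : R := plim P (fun n (s : n.-tuple T) => (beta_hat s).2).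
Definition pi0_IV : R := plim P (fun n (s : n.-tuple T) => (pi_hat s).1).
Definition pi1_IV : R := plim P (fun n (s : n.-tuple T) => (pi_hat s).2).
Definition tau0_IV : R := plim P (fun n (s : n.-tuple T) => (tau_hat s).1).
Definition tau1_IV : R := plim P (fun n (s : n.-tuple T) => (tau_hat s).2).

Definition NIE0_IV : R :=
  beta1_IV * (pi0_IV - tau0_IV + (pi1_IV - tau1_IV) * mean P Zr).

End mediation.

Arguments mediation_model {d T R} P.

(* Main.v *)
(** The regressions of Y on M and of M on Z within a stratum D = g solve 2 x 2
    linear systems whose coefficients are sample averages of integrable
    variables. A weak law of large numbers for integrable variables (truncation
    to simple functions, Chebyshev and Markov) and Cramer's rule give the
    probability limits as the same rational functions of population moments.
    Randomization and exogeneity factor these moments, so that the slopes become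
    Wald ratios: beta_1 is (E[Y_{0,M_{01}}] - E[Y_{0,M_{00}}]) / (E[M_{01}] -
    E[M_{00}]), and pi_0 + pi_1 z, tau_0 + tau_1 z are E[M_{1z}], E[M_{0z}].
    Monotonicity turns every difference E[F_{V1}] - E[F_{V0}] with V1 >= V0 into
    an expectation over the individuals with V1 > V0. The two quantities differ
    when those who respond to D have another effect of M on Y than those who
    respond to Z. *)

From HB Require Import structures.
Require Import Defs.
From mathcomp Require Import all_boot all_order all_algebra.
From mathcomp Require Import all_classical all_reals all_analysis.
From mathcomp Require Import measurable_realfun ring lra.
Set Implicit Arguments.
Unset Strict Implicit.
Unset Printing Implicit Defensive.
Import Order.TTheory GRing.Theory Num.Theory.
Import numFieldNormedType.Exports HBSimple.
Local Open Scope classical_set_scope.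
Local Open Scope ring_scope.

(** * Measurability of inverses and of boolean variables *)

Section measurable_bool.
Context {d : measure_display} {T : measurableType d} {R : realType}.

(** Real powers are measurable and agree with the inverse on nonnegative bases, so the inverse is
    written as f times the power -1 of f ^ 2. At zeros of f both sides are 0. *)
Lemma measurable_funV (f : T -> R) :
  measurable_fun setT f -> measurable_fun setT (fun t => (f t)^-1).
Proof.
move=> mf; have -> : (fun t => (f t)^-1) =
    (fun t => f t * powR (f t * f t) (-1)).
  apply/funext => t; rewrite powR_inv1 -?expr2 ?sqr_ge0//.
  have [->|f0] := eqVneq (f t) 0; first by rewrite mul0r invr0.
  by rewrite expr2 invfM mulrA divff// mul1r.
apply: measurable_funM => //.
apply: (@measurableT_comp _ _ _ _ _ _ (@powR R ^~ (-1)) _ (fun t => f t * f t)).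
  exact: measurable_powR.
exact: measurable_funM.
Qed.

Lemma measurable_fun_div (f g : T -> R) : measurable_fun setT f ->
  measurable_fun setT g -> measurable_fun setT (fun t => f t / g t).
Proof. by move=> mf mg; apply: measurable_funM => //; exact: measurable_funV. Qed.

Lemma measurable_boolR (b : T -> bool) :
  measurable_fun setT b -> measurable_fun setT (fun t => (b t)%:R : R).
Proof.
move=> mb; have -> : (fun t => (b t)%:R) = (fun t => if b t then 1 else 0 : R).
  by apply/funext => t; case: (b t).
exact: measurable_fun_ifT.
Qed.

Lemma measurable_eqb (b c : T -> bool) : measurable_fun setT b ->
  measurable_fun setT c -> measurable_fun setT (fun t => b t == c t).
Proof.
move=> mb mc; have -> : (fun t => b t == c t) =
    (fun t => if b t then c t else ~~ c t).
  by apply/funext => t; case: (b t); case: (c t).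
by apply: measurable_fun_ifT => //; exact: measurable_neg.
Qed.

Lemma measurable_bool_set (b : T -> bool) (c : bool) :
  measurable_fun setT b -> measurable [set t | b t = c].
Proof. by move=> mb; have := mb measurableT [set c]; rewrite setTI; exact. Qed.

End measurable_bool.

(** * Moments of sums over a random sample *)

Section sample_law_integral.
Context {d : measure_display} {T : measurableType d} {R : realType}.
Variable P : probability T R.

(** Change of variables along [tuple_cons], then Tonelli. The newest observation is integrated
    first, with the older ones fixed, which drives the inductions on the sample size. *)
Lemma integral_sample_lawS n (F : n.+1.-tuple T -> \bar R) :
  measurable_fun setT F -> (forall s, 0 <= F s)%E ->
  (\int[sample_law P n.+1]_s F s =
   \int[sample_law P n]_s \int[P]_t F (tuple_cons (t, s)))%E.
Proof.
move=> mF F0.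
have mFc : measurable_fun setT (F \o @tuple_cons d T n).
  by apply: measurableT_comp => //; exact: measurable_tuple_cons.
rewrite [LHS]ge0_integral_distribution//.
by rewrite fubini_tonelli2// => x; exact: F0.
Qed.

Lemma measurable_sample_sum n (f : T -> R) : measurable_fun setT f ->
  measurable_fun [set: n.-tuple T] (fun s => \sum_(t <- s) f t).
Proof.
move=> mf; under eq_fun do rewrite big_tuple.
apply: measurable_sum => i; apply: measurableT_comp => //.
exact: measurable_tnth.
Qed.

Lemma integral_sample_sum (h : T -> R) : measurable_fun setT h ->
  (forall t, 0 <= h t) -> P.-integrable setT (EFin \o h) ->
  forall n, (\int[sample_law P n]_s (\sum_(t <- s) h t)%:E =
    (n%:R * \int[P]_t h t)%:E)%E.
Proof.
move=> mh h0 ih; elim => [|n IH].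
  rewrite integral_dirac//; last first.
    by apply/measurable_EFinP; exact: measurable_sample_sum.
  by rewrite diracT mul1e big_nil mul0r.
rewrite integral_sample_lawS; last 2 first.
- by apply/measurable_EFinP; exact: measurable_sample_sum.
- by move=> s; rewrite lee_fin sumr_ge0.
have inner (s : n.-tuple T) :
    (\int[P]_t (\sum_(u <- tuple_cons (t, s)) h u)%:E =
     ((\int[P]_t h t) + \sum_(t <- s) h t)%:E)%E.
  under eq_integral => t _ do rewrite big_cons EFinD.
  have S0 : 0 <= \sum_(t <- s) h t by rewrite sumr_ge0.
  have mh' : measurable_fun setT (fun t => (h t)%:E) by apply/measurable_EFinP.
  have h0' t : (0 <= (h t)%:E)%E by rewrite lee_fin.
  rewrite ge0_integralD//=.
  rewrite integral_cst//= probability_setT mule1 EFinD; congr (_ + _)%E.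
  by rewrite fineK//; exact: integrable_fin_num.
under eq_integral => s _ do rewrite inner EFinD.
have mS : measurable_fun setT (fun s : n.-tuple T => (\sum_(t <- s) h t)%:E).
  by apply/measurable_EFinP; exact: measurable_sample_sum.
have S0 (s : n.-tuple T) : (0 <= (\sum_(t <- s) h t)%:E)%E.
  by rewrite lee_fin sumr_ge0.
have I0 : (0 <= (\int[P]_t h t)%:E)%E by rewrite lee_fin Rintegral_ge0.
rewrite ge0_integralD//=.
rewrite IH integral_cst//= [X in (_ * X)%E]probability_setT mule1 -EFinD.
by rewrite -natr1 mulrDl mul1r addrC.
Qed.

(* The cross terms vanish already in the inner integral over the newly added
   observation, so only Tonelli's theorem is needed. *)
Lemma integral_sample_sum_sqr (g : T -> R) : measurable_fun setT g ->
  P.-integrable setT (EFin \o g) ->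
  P.-integrable setT (EFin \o (fun t => g t ^+ 2)) ->
  \int[P]_t g t = 0 ->
  forall n, (\int[sample_law P n]_s ((\sum_(t <- s) g t) ^+ 2)%:E =
    (n%:R * \int[P]_t g t ^+ 2)%:E)%E.
Proof.
move=> mg ig ig2 g0; elim => [|n IH].
  rewrite integral_dirac//; last first.
    by apply/measurable_EFinP/measurable_funX; exact: measurable_sample_sum.
  by rewrite diracT mul1e big_nil mul0r expr0n.
rewrite integral_sample_lawS; last 2 first.
- by apply/measurable_EFinP/measurable_funX; exact: measurable_sample_sum.
- by move=> s; rewrite lee_fin sqr_ge0.
have inner (s : n.-tuple T) :
    (\int[P]_t ((\sum_(u <- tuple_cons (t, s)) g u) ^+ 2)%:E =
     ((\int[P]_t g t ^+ 2) + (\sum_(t <- s) g t) ^+ 2)%:E)%E.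
  set S := \sum_(t <- s) g t.
  transitivity (\int[P]_t ((g t ^+ 2)%:E + (((2 * S) * g t)%:E + (S ^+ 2)%:E)))%E.
    apply: eq_integral => t _; rewrite big_cons -/S -!EFinD; congr EFin.
    by ring.
  have ilin : P.-integrable setT (fun t => ((2 * S) * g t)%:E).
    by under eq_fun do rewrite EFinM; exact: integrableZl.
  have icst : P.-integrable setT (fun t => (S ^+ 2)%:E).
    exact: finite_measure_integrable_cst.
  rewrite integralD//=; last exact: integrableD.
  rewrite integralD//= integral_cst//= probability_setT mule1.
  under [X in (_ + (X + _))%E]eq_integral do rewrite EFinM.
  rewrite integralZl//=.
  rewrite -[X in (_ + (_ * X + _))%E]fineK; last exact: integrable_fin_num.
  rewrite -[X in (X + _)%E]fineK; last exact: integrable_fin_num.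
  rewrite [X in (_ + (_ * X%:E + _))%E]g0 mule0 add0e.
  by rewrite EFinD.
under eq_integral => s _ do rewrite inner EFinD.
have mS : measurable_fun setT
    (fun s : n.-tuple T => ((\sum_(t <- s) g t) ^+ 2)%:E).
  by apply/measurable_EFinP/measurable_funX; exact: measurable_sample_sum.
have S0 (s : n.-tuple T) : (0 <= ((\sum_(t <- s) g t) ^+ 2)%:E)%E.
  by rewrite lee_fin sqr_ge0.
have I0 : (0 <= (\int[P]_t g t ^+ 2)%:E)%E.
  by rewrite lee_fin Rintegral_ge0// => t _; exact: sqr_ge0.
rewrite ge0_integralD//=.
rewrite IH integral_cst//= [X in (_ * X)%E]probability_setT mule1 -EFinD.
by rewrite -natr1 mulrDl mul1r addrC.
Qed.

End sample_law_integral.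

(** * Convergence in probability and the weak law of large numbers *)

Section convergence_in_probability.
Context {d : measure_display} {T : measurableType d} {R : realType}.
Variable P : probability T R.

Lemma le_probabilityU2 (d' : measure_display) (U : measurableType d')
    (Q : probability U R) (A B C : set U) (a b : R) :
  measurable A -> measurable B -> measurable C -> C `<=` A `|` B ->
  (Q A <= a%:E)%E -> (Q B <= b%:E)%E -> (Q C <= (a + b)%:E)%E.
Proof.
move=> mA mB mC CAB Aa Bb; apply: (@le_trans _ _ (Q (A `|` B))).
  by apply: le_measure; rewrite ?inE//; exact: measurableU.
by apply: (le_trans (measureU2 _ mA mB)); rewrite EFinD leeD.
Qed.

Lemma ge0_cvge0P (u : nat -> \bar R) : (forall n, 0 <= u n)%E ->
  (u n @[n --> \oo] --> 0%E) <->
  (forall e : R, 0 < e -> \forall n \near \oo, (u n <= e%:E)%E).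
Proof.
move=> u0; split=> [/fine_cvgP[ufin /cvgrPdist_le ucvg] e e0|ule].
  near=> n; have ufn : u n \is a fin_num by near: n.
  rewrite -[u n]fineK// lee_fin (le_trans (ler_norm _))//.
  rewrite -normrN -[X in `|X|]sub0r.
  by near: n; exact: ucvg.
apply/fine_cvgP; split.
  near=> n; have un1 : (u n <= 1%:E)%E by near: n; exact: ule.
  by rewrite ge0_fin_numE// (le_lt_trans un1)// ltry.
apply/cvgrPdist_le => e e0; near=> n.
have une : (u n <= e%:E)%E by near: n; exact: ule.
rewrite sub0r normrN /= ger0_norm ?fine_ge0//.
by rewrite -lee_fin fineK// ge0_fin_numE// (le_lt_trans une)// ltry.
Unshelve. all: by end_near. Qed.

Lemma cvg_in_probabilityP (X : estimator T R) (c : R) :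
  cvg_in_probability P X c <->
  (forall e r : R, 0 < e -> 0 < r -> \forall n \near \oo,
    (sample_law P n [set s | (e <= `|X n s - c|)%R] <= r%:E)%E).
Proof.
split=> [H e r e0 r0|H e e0].
  by have /ge0_cvge0P := H e e0; apply => // n; exact: measure_ge0.
by apply/ge0_cvge0P => [n|r r0]; [exact: measure_ge0|exact: H].
Qed.

(* Without measurability, the values of the sample laws in
   [cvg_in_probability] carry no information. *)
Definition consistent (X : estimator T R) (c : R) :=
  (forall n, measurable_fun setT (X n)) /\ cvg_in_probability P X c.

Lemma eq_consistent X Y c : (forall n (s : n.-tuple T), Y n s = X n s) ->
  consistent X c -> consistent Y c.
Proof.
by move=> YX; have -> : Y = X by apply: functional_extensionality_dep => n;
  apply/funext => s.
Qed.

Lemma measurable_deviation n (X : n.-tuple T -> R) (c e : R) :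
  measurable_fun setT X -> measurable [set s | e <= `|X s - c|].
Proof.
move=> mX; apply: (measurable_bool_set (b := fun s => e <= `|X s - c|) true).
apply: measurable_fun_ler => //; apply: measurableT_comp => //.
exact: measurable_funB.
Qed.

(** If a and b differ, every sample is at distance at least |a - b| / 2 from one of them. For large
    n each of these two events has probability at most 1/4, yet together they cover the whole
    space. *)
Lemma consistent_unique X a b : consistent X a -> cvg_in_probability P X b ->
  a = b.
Proof.
move=> [mX /cvg_in_probabilityP Xa] /cvg_in_probabilityP Xb.
apply/eqP; apply: contraT => ab.
have e0 : 0 < `|a - b| / 2 by rewrite divr_gt0// normr_gt0 subr_eq0.
have r0 : 0 < 4^-1 :> R by rewrite invr_gt0.
have [N _ {}Xa] := Xa _ _ e0 r0; have [N' _ {}Xb] := Xb _ _ e0 r0.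
pose n := maxn N N'.
have {}Xa := Xa n (leq_maxl _ _); have {}Xb := Xb n (leq_maxr _ _).
have : (sample_law P n setT <= (4^-1 + 4^-1 : R)%:E)%E.
  apply: le_probabilityU2 Xa Xb => //; try exact: measurable_deviation.
  move=> s _ /=.
  have [?|lt1] := leP (`|a - b| / 2) `|X n s - a|; first by left.
  have [?|lt2] := leP (`|a - b| / 2) `|X n s - b|; first by right.
  have := ler_distD (X n s) a b; rewrite (distrC a (X n s)); lra.
by rewrite probability_setT lee_fin; lra.
Qed.

Lemma consistent_plim X c : consistent X c -> plim P X = c.
Proof.
move=> Xc; apply: xget_unique; first by case: Xc.
by move=> b /(consistent_unique Xc).
Qed.

(** The continuous mapping theorem. Continuity is asked at the limit point only, so that division is
    covered as soon as the limit of the denominator is nonzero. *)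
Lemma consistent_map2 (op : R -> R -> R) X Y a b :
  (forall n, measurable_fun setT (fun s => op (X n s) (Y n s))) ->
  op z.1 z.2 @[z --> (a, b)] --> op a b ->
  consistent X a -> consistent Y b ->
  consistent (fun n s => op (X n s) (Y n s)) (op a b).
Proof.
move=> mop cop [mX /cvg_in_probabilityP Xa] [mY /cvg_in_probabilityP Yb].
split => //; apply/cvg_in_probabilityP => e r e0 r0.
have r20 : 0 < r / 2 by rewrite divr_gt0.
move/cvgrPdist_lt : cop => /(_ e e0) /nbhs_ballP[/= del del0 Hdel].
near=> n.
have Xan : (sample_law P n [set s | (del <= `|X n s - a|)%R] <= (r / 2)%:E)%E.
  by near: n; exact: Xa.
have Ybn : (sample_law P n [set s | (del <= `|Y n s - b|)%R] <= (r / 2)%:E)%E.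
  by near: n; exact: Yb.
rewrite [r]splitr; apply: le_probabilityU2 Xan Ybn;
  try exact: measurable_deviation.
move=> s /= opge.
have [?|lt1] := leP del `|X n s - a|; first by left.
have [?|lt2] := leP del `|Y n s - b|; first by right.
have /Hdel /= : ball (a, b) del (X n s, Y n s).
  by split => /=; rewrite /ball/= distrC.
by rewrite ltNge distrC opge.
Unshelve. all: by end_near. Qed.

Lemma consistentB X Y a b : consistent X a -> consistent Y b ->
  consistent (fun n s => X n s - Y n s) (a - b).
Proof.
move=> Xa Yb; apply: (consistent_map2 (op := fun x y => x - y)) => //.
  by move=> n; apply: measurable_funB; [exact: (proj1 Xa)|exact: (proj1 Yb)].
by apply: cvgB; [exact: cvg_fst|exact: cvg_snd].
Qed.

Lemma consistentM X Y a b : consistent X a -> consistent Y b ->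
  consistent (fun n s => X n s * Y n s) (a * b).
Proof.
move=> Xa Yb; apply: (consistent_map2 (op := fun x y => x * y)) => //.
  by move=> n; apply: measurable_funM; [exact: (proj1 Xa)|exact: (proj1 Yb)].
by apply: cvgM; [exact: cvg_fst|exact: cvg_snd].
Qed.

Lemma consistent_div X Y a b : b != 0 -> consistent X a -> consistent Y b ->
  consistent (fun n s => X n s / Y n s) (a / b).
Proof.
move=> b0 Xa Yb; apply: (consistent_map2 (op := fun x y => x / y)) => //.
  by move=> n; apply: measurable_fun_div; [exact: (proj1 Xa)|exact: (proj1 Yb)].
apply: cvgM; first exact: cvg_fst.
by apply: cvgV => //; exact: cvg_snd.
Qed.

Lemma markov_ge0 (d' : measure_display) (U : measurableType d')
    (Q : probability U R) (X : U -> R) (c : R) :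
  0 < c -> measurable_fun setT X -> (forall s, 0 <= X s) ->
  (c%:E * Q [set s | (c <= X s)%R] <= \int[Q]_s (X s)%:E)%E.
Proof.
move=> c0 mX X0.
have := @le_integral_comp_abse _ U R Q setT measurableT (EFin \o X) c id.
move=> /(_ _ _ _ _ c0); under eq_integral do rewrite /= ger0_norm//.
rewrite setTI.
have -> : [set x | (c%:E <= `|(EFin \o X) x|)%E] = [set s | c <= X s].
  by apply/seteqP; split => x /=; rewrite ger0_norm// lee_fin.
by apply => //; exact/measurable_EFinP.
Qed.

Definition sample_mean (f : T -> R) : estimator T R :=
  fun n s => n%:R^-1 * \sum_(t <- s) f t.

Lemma measurable_sample_mean f n : measurable_fun setT f ->
  measurable_fun setT (@sample_mean f n).
Proof. by move=> mf; apply: measurable_funM => //; exact: measurable_sample_sum. Qed.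

Lemma sample_meanB f g n (s : n.-tuple T) :
  sample_mean (fun t => f t - g t) s = sample_mean f s - sample_mean g s.
Proof. by rewrite /sample_mean sumrB mulrBr. Qed.

Lemma sample_mean_cst (a : R) n (s : n.+1.-tuple T) :
  sample_mean (fun=> a) s = a.
Proof.
by rewrite /sample_mean big_tuple sumr_const card_ord -[a *+ _]mulr_natl mulKf.
Qed.

(** Markov's inequality for the sample mean. The bound does not depend on n and uses a first moment
    only; it will control the truncation error. *)
Lemma sample_mean_tail (h : T -> R) (c : R) n : 0 < c ->
  measurable_fun setT h -> (forall t, 0 <= h t) ->
  P.-integrable setT (EFin \o h) ->
  (sample_law P n.+1 [set s | (c <= sample_mean h s)%R]
   <= ((\int[P]_t h t) / c)%:E)%E.
Proof.
move=> c0 mh h0 ih.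
have n0 : 0 < n.+1%:R :> R by [].
have S0 (s : n.+1.-tuple T) : 0 <= \sum_(t <- s) h t by rewrite sumr_ge0.
have := @markov_ge0 _ _ (sample_law P n.+1) (fun s => \sum_(t <- s) h t)
  (n.+1%:R * c) (mulr_gt0 n0 c0) (measurable_sample_sum mh) S0.
rewrite integral_sample_sum//.
have -> : [set s : n.+1.-tuple T | n.+1%:R * c <= \sum_(t <- s) h t] =
    [set s | c <= sample_mean h s].
  by apply/seteqP; split => s /=; rewrite /sample_mean ler_pdivlMl.
rewrite -lee_pdivlMl ?mulr_gt0// => /le_trans; apply.
rewrite -EFinM lee_fin le_eqVlt; apply/orP; left; apply/eqP.
by field; rewrite gt_eqF//= pnatr_eq0.
Qed.

(** Chebyshev's inequality: the second moment of a centered sum grows like n, that of the mean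
    decays like 1 / n. *)
Lemma sample_mean_sqr_tail (g : T -> R) (c : R) n : 0 < c ->
  measurable_fun setT g -> P.-integrable setT (EFin \o g) ->
  P.-integrable setT (EFin \o (fun t => g t ^+ 2)) ->
  \int[P]_t g t = 0 ->
  (sample_law P n.+1 [set s | (c <= `|sample_mean g s|)%R]
   <= ((\int[P]_t g t ^+ 2) / c ^+ 2 * n.+1%:R^-1)%:E)%E.
Proof.
move=> c0 mg ig ig2 g0.
have n0 : 0 < n.+1%:R :> R by [].
have nc0 : 0 < (n.+1%:R * c) ^+ 2 by rewrite exprn_gt0// mulr_gt0.
have := @markov_ge0 _ _ (sample_law P n.+1)
  (fun s => (\sum_(t <- s) g t) ^+ 2) ((n.+1%:R * c) ^+ 2) nc0
  (measurable_funX _ (measurable_sample_sum mg)) (fun=> sqr_ge0 _).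
rewrite integral_sample_sum_sqr//.
have -> : [set s : n.+1.-tuple T | (n.+1%:R * c) ^+ 2
      <= (\sum_(t <- s) g t) ^+ 2] = [set s | c <= `|sample_mean g s|].
  apply: eq_set => s; congr is_true; rewrite -[X in _ <= X]real_normK ?num_real//.
  rewrite ler_sqr ?nnegrE ?mulr_ge0 ?(ltW c0)//.
  by rewrite /sample_mean normrM normfV (ger0_norm (ler0n _ _)) ler_pdivlMl.
rewrite -lee_pdivlMl// => /le_trans; apply.
rewrite -EFinM lee_fin le_eqVlt; apply/orP; left; apply/eqP.
by field; rewrite nat1r pnatr_eq0 /= gt_eqF.
Qed.

Lemma sfun_approx (f : T -> R) (e : R) : 0 < e ->
  P.-integrable setT (EFin \o f) ->
  exists g : {sfun T >-> R}, \int[P]_t `|f t - g t| <= e.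
Proof.
move=> e0 intf.
have [g [ig _ fg]] := approximation_sfun_integrable measurableT intf.
move: fg => /ge0_cvge0P fg.
have [//|] := fg _ e e0.
  by move=> n; exact: integral_ge0.
move=> N _ /(_ N (leqnn _)) le; exists (g N).
rewrite /Rintegral -lee_fin fineK//.
rewrite ge0_fin_numE ?integral_ge0//.
exact: le_lt_trans le (ltry _).
Qed.

(** Only a first moment is available, so f is replaced by a simple function g close to it in L1. The
    centered g is bounded and obeys Chebyshev; Markov controls the sample mean of |f - g| uniformly
    in n; the L1 distance bounds the difference of the means. *)
Theorem weak_law_of_large_numbers (f : T -> R) :
  P.-integrable setT (EFin \o f) ->
  consistent (sample_mean f) (\int[P]_t f t).
Proof.
move=> intf; have mf : measurable_fun setT f.
  by apply/measurable_EFinP; exact: measurable_int intf.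
split; first by move=> n; exact: measurable_sample_mean.
apply/cvg_in_probabilityP => e r e0 r0.
(* The bound e / 4 is for the difference of the means, and e * r / 8 makes Markov's bound at level e
   / 4 equal to r / 2. *)
pose del := Num.min (e / 4) (e * r / 8).
have del0 : 0 < del by rewrite lt_min !divr_gt0// mulr_gt0.
have [g fg] := sfun_approx del0 intf.
have mg : measurable_fun setT g by [].
have PT : (P setT < +oo)%E by rewrite probability_setT ltry.
have intg : P.-integrable setT (EFin \o g).
  by apply: measurable_bounded_integrable => //; exact: simple_bounded.
have inth : P.-integrable setT (EFin \o (fun t => f t - g t)).
  by have := integrableB measurableT intf intg; apply.
pose h t : R := `|f t - g t|.
have intah : P.-integrable setT (EFin \o h).
  exact: integrable_norm inth.
have mh : measurable_fun setT h.
  by apply: measurableT_comp => //; exact: measurable_funB.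
pose m := \int[P]_t g t.
pose k t := g t - m.
have mk : measurable_fun setT k by exact: measurable_funB.
have bk : bounded_fun k.
  have [M [_ gM]] := simple_bounded g.
  exists (M + 1 + `|m|); split; first exact: num_real.
  move=> x /ltW Mx t _; apply: le_trans (ler_normB _ _) (le_trans _ Mx).
  by rewrite lerD2r; apply: (gM (M + 1)) => //; rewrite ltrDl.
have intk : P.-integrable setT (EFin \o k).
  exact: measurable_bounded_integrable.
have intk2 : P.-integrable setT (EFin \o (fun t => k t ^+ 2)).
  exact: (integrableMr measurableT mk bk intk).
have k0 : \int[P]_t k t = 0.
  rewrite /k RintegralB//; last exact: finite_measure_integrable_cst.
  by rewrite Rintegral_cst// [X in fine X]probability_setT mulr1 subrr.
pose v := \int[P]_t k t ^+ 2.
have fgm : `|\int[P]_t f t - m| <= e / 4.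
  rewrite /m -RintegralB//; apply: le_trans (le_normr_Rintegral _ _) _ => //.
  by apply: le_trans fg _; rewrite ge_min lexx.
have e4 : 0 < e / 4 by rewrite divr_gt0.
pose C := v / (e / 4) ^+ 2.
have C0 : 0 <= C.
  by rewrite divr_ge0 ?sqr_ge0// Rintegral_ge0// => t _; exact: sqr_ge0.
(* C + 1 replaces C because the variance of g may be 0. *)
have C10 : 0 < r / 2 / (C + 1) by rewrite !divr_gt0// ltr_wpDl.
have [N _ HN] := near_infty_natSinv_lt (PosNum C10).
exists N.+1 => // -[//|n] /= Nn.
have Bk := sample_mean_sqr_tail n e4 mk intk intk2 k0.
have Bh := sample_mean_tail n e4 mh (fun=> normr_ge0 _) intah.
have {}Bk : (sample_law P n.+1 [set s | (e / 4 <= `|sample_mean k s - 0|)%R]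
    <= (r / 2)%:E)%E.
  under eq_set do rewrite subr0.
  apply: le_trans Bk _; rewrite lee_fin.
  have /ltW := HN n Nn; rewrite /= => nN.
  apply: (@le_trans _ _ ((C + 1) * (r / 2 / (C + 1)))); last first.
    by rewrite mulrC divfK// gt_eqF// ltr_wpDl.
  by apply: ler_pM; rewrite ?invr_ge0 ?lerDl.
have {}Bh : (sample_law P n.+1 [set s | (e / 4 <= sample_mean h s)%R]
    <= (r / 2)%:E)%E.
  apply: le_trans Bh _; rewrite lee_fin ler_pdivrMr//; apply: le_trans fg _.
  by rewrite ge_min; apply/orP; right; lra.
rewrite [r]splitr; apply: (@le_probabilityU2 _ _ (sample_law P n.+1) _ _ _ _ _ _ _ _ _ Bk Bh).
- exact: measurable_deviation _ _ (measurable_sample_mean mk).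
- apply: (measurable_bool_set (b := fun s => e / 4 <= sample_mean h s) true).
  by apply: measurable_fun_ler => //; exact: measurable_sample_mean.
- exact: measurable_deviation _ _ (measurable_sample_mean mf).
move=> s /= sge.
have [?|lt1] := leP (e / 4) `|sample_mean k s - 0|; first by left.
have [?|lt2] := leP (e / 4) (sample_mean h s); first by right.
move: sge; rewrite leNgt => /negP; case.
have kE : sample_mean k s = sample_mean g s - m.
  by rewrite /k sample_meanB sample_mean_cst.
have hE : `|sample_mean f s - sample_mean g s| <= sample_mean h s.
  rewrite -sample_meanB /sample_mean normrM ger0_norm ?invr_ge0//.
  by rewrite ler_wpM2l ?invr_ge0// ler_norm_sum.
(* Off the two exceptional events, each of the three terms is at most e / 4 in absolute value, so
   the deviation stays below e. *)
rewrite (_ : _ - _ = (sample_mean f s - sample_mean g s) + sample_mean k s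
  - (\int[P]_t f t - m)); last by rewrite kE; ring.
apply: le_lt_trans (ler_normB _ _) _.
have := ler_normD (sample_mean f s - sample_mean g s) (sample_mean k s).
by move: lt1 lt2 hE fgm; rewrite subr0; lra.
Qed.
End convergence_in_probability.

(** * Closed form and consistency of the IV coefficients *)

Section iv_coefficients.
Context {d : measure_display} {T : measurableType d} {R : realType}.

(* When the determinant is 0, both sides are (0, 0): the left one by default,
   the right one because x / 0 = 0. *)
Lemma xget_cramer2 (n x y w wx wy : R) (det := n * wx - w * x) :
  xget (0, 0) [set c : R * R | [set e : R * R | y - (e.1 * n + e.2 * x) = 0
      /\ wy - (e.1 * w + e.2 * wx) = 0] = [set c]]
  = ((y * wx - x * wy) / det, (n * wy - w * y) / det).
Proof.
set sol := (X in [set c | X = [set c]]).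
have [det0|det0] := eqVneq det 0; last first.
  apply: xget_unique.
    apply/seteqP; split => [[a b] /= [/eqP + /eqP]|_ -> /=].
      rewrite !subr_eq0 => /eqP -> /eqP -> /=.
      by congr pair; rewrite /det; field; exact: det0.
    by split; rewrite /det /=; field; exact: det0.
  move=> c solc.
  have : sol c by rewrite solc.
  case: c {solc} => a b /= [/eqP + /eqP].
  rewrite !subr_eq0 => /eqP -> /eqP -> /=.
  by congr pair; rewrite /det; field; exact: det0.
rewrite det0 invr0 !mulr0; apply: xgetPN => -[a b] /= solab.
have [s1 s2] : sol (a, b) by rewrite solab.
(* Adding a kernel vector to the unique solution gives a solution again, so the kernel is
   trivial. *)
have kernel u v : n * u + x * v = 0 -> w * u + wx * v = 0 -> u = 0 /\ v = 0.
  move=> nu wu; have : sol (a + u, b + v).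
    by rewrite /sol /=; move: s1 s2 nu wu => /=; split; lra.
  rewrite solab => -[ua vb]; split.
    by move/eqP: ua; rewrite -subr_eq0 addrAC subrr add0r => /eqP.
  by move/eqP: vb; rewrite -subr_eq0 addrAC subrr add0r => /eqP.
rewrite /det in det0.
(* As the determinant is 0, the columns of the adjugate matrix, up to sign, lie in the kernel. Hence
   the matrix is 0, and (1, 0) lies in the kernel too, which is absurd. *)
have [||x0 /eqP] := kernel x (- n); [by ring|by move: det0; lra|].
rewrite oppr_eq0 => /eqP n0.
have [|| wx0 /eqP] := kernel wx (- w); [by move: det0; lra|by ring|].
rewrite oppr_eq0 => /eqP w0.
have [||/eqP] := kernel 1 0; [by rewrite n0; ring|by rewrite w0; ring|].
by rewrite oner_eq0.
Qed.

Section moments.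
Variables (D : T -> bool) (g : bool) (Y X W : T -> R).

Let S (h : T -> R) (s : seq T) : R := \sum_(t <- s) (D t == g)%:R * h t.

(** Sums over the subsample D = g become sums of indicator-weighted variables over the full sample,
    the form to which the law of large numbers applies. *)
Lemma iv_coef_cramer (s : seq T)
    (det := S (cst 1) s * S (fun t => W t * X t) s - S W s * S X s) :
  iv_coef D g Y X W s =
    ((S Y s * S (fun t => W t * X t) s - S X s * S (fun t => W t * Y t) s) / det,
     (S (cst 1) s * S (fun t => W t * Y t) s - S W s * S Y s) / det).
Proof.
have SE (h : T -> R) : \sum_(t <- s | D t == g) h t = S h s.
  rewrite /S big_mkcond; apply: eq_bigr => t _.
  by case: (D t == g); rewrite ?mul1r ?mul0r.
rewrite /iv_coef /iv_moments /det -xget_cramer2; congr xget.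
apply: eq_set => c; congr (_ = _); apply: eq_set => e.
rewrite !SE /S; congr and; congr eq.
  by rewrite !mulr_sumr -big_split/= -sumrB; apply: eq_bigr => t _ /=; ring.
by rewrite !mulr_sumr -big_split/= -sumrB; apply: eq_bigr => t _; ring.
Qed.

Variable P : probability T R.

Let E (h : T -> R) : R := \int[P]_t ((D t == g)%:R * h t).

Definition moments_exist (h : T -> R) :=
  P.-integrable setT (EFin \o (fun t => (D t == g)%:R * h t)).

(** Cramer's quotients are homogeneous of degree 0 in the sums, so sample means may replace the
    sums; consistency then passes through products, differences and a quotient with nonzero limit
    determinant. *)
Lemma iv_coef_consistent
    (det := E (cst 1) * E (fun t => W t * X t) - E W * E X) :
  moments_exist (cst 1) -> moments_exist Y -> moments_exist X ->
  moments_exist W -> moments_exist (fun t => W t * X t) ->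
  moments_exist (fun t => W t * Y t) -> det != 0 ->
  consistent P (fun n (s : n.-tuple T) => (iv_coef D g Y X W s).1)
    ((E Y * E (fun t => W t * X t) - E X * E (fun t => W t * Y t)) / det) /\
  consistent P (fun n (s : n.-tuple T) => (iv_coef D g Y X W s).2)
    ((E (cst 1) * E (fun t => W t * Y t) - E W * E Y) / det).
Proof.
move=> i1 iY iX iW iWX iWY det0.
pose A (h : T -> R) : estimator T R :=
  sample_mean (fun t => (D t == g)%:R * h t).
have AS h n (s : n.-tuple T) : A h n s = n%:R^-1 * S h s by [].
have Acons h : moments_exist h -> consistent P (A h) (E h).
  exact: weak_law_of_large_numbers.
pose Adet : estimator T R := fun n s =>
  A (cst 1) n s * A (fun t => W t * X t) n s - A W n s * A X n s.
have cdet : consistent P Adet det.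
  by apply: consistentB; apply: consistentM; exact: Acons.
have coefE n (s : n.-tuple T) : iv_coef D g Y X W s =
   ((A Y n s * A (fun t => W t * X t) n s
      - A X n s * A (fun t => W t * Y t) n s) / Adet n s,
    (A (cst 1) n s * A (fun t => W t * Y t) n s - A W n s * A Y n s) / Adet n s).
  rewrite iv_coef_cramer /Adet !AS; case: n s => [|n] s.
    (* For the empty sample all numerators are 0, on both sides. *)
    by rewrite tuple0 /S !big_nil !(mul0r, mulr0, subr0).
  have scale (a b c e : R) : a * b - c * e = n.+1%:R ^+ 2 *
      (n.+1%:R^-1 * a * (n.+1%:R^-1 * b) - n.+1%:R^-1 * c * (n.+1%:R^-1 * e)).
    by field; rewrite nat1r pnatr_eq0.
  have n2 : (n.+1%:R : R) ^+ 2 != 0 by rewrite expf_neq0// pnatr_eq0.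
  by congr pair; rewrite [in LHS]scale [X in _ / X]scale -mulf_div divff// mul1r.
by split; (apply: eq_consistent => [n s|]; [rewrite coefE /=; reflexivity|]);
  apply: consistent_div => //; apply: consistentB; apply: consistentM;
  exact: Acons.
Qed.

End moments.
End iv_coefficients.

(** * Integrals of variables selected by, or conditioned on, booleans *)

Section conditioning_on_booleans.
Context {d : measure_display} {T : measurableType d} {R : realType}.
Variable P : probability T R.

Lemma meanE (X : T -> R) : mean P X = \int[P]_t X t.
Proof. by rewrite /mean unlock. Qed.

Lemma Rintegral_bool_set (b : T -> bool) (X : T -> R) :
  \int[P]_(t in [set t | b t]) X t = \int[P]_t ((b t)%:R * X t).
Proof.
rewrite Rintegral_mkcond; apply: eq_Rintegral => t _; rewrite patchE mem_setE.
by rewrite unfold_in; case: (b t); rewrite ?mul1r ?mul0r.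
Qed.

Lemma eq_bool_set (W : T -> bool) (w : bool) :
  [set t | W t = w] = [set t | W t == w].
Proof. by apply/seteqP; split=> [t /= ->|t /= /eqP ->]. Qed.

Lemma pr_Rintegral (b : T -> bool) : measurable_fun setT b ->
  pr P [set t | b t] = \int[P]_t (b t)%:R.
Proof.
move=> mb; rewrite /pr -[LHS]mul1r -Rintegral_cst; last first.
  exact: (measurable_bool_set true).
by rewrite Rintegral_bool_set; apply: eq_Rintegral => t _; rewrite mulr1.
Qed.

Lemma pr_eq_Rintegral (W : T -> bool) (w : bool) : measurable_fun setT W ->
  pr P [set t | W t = w] = \int[P]_t (W t == w)%:R.
Proof.
by move=> mW; rewrite eq_bool_set pr_Rintegral//; exact: measurable_eqb.
Qed.

Lemma integrable_boolM (b : T -> bool) (X : T -> R) : measurable_fun setT b ->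
  P.-integrable setT (EFin \o X) ->
  P.-integrable setT (EFin \o (fun t => (b t)%:R * X t)).
Proof.
move=> mb iX; apply: (integrableMr (h := fun t => (b t)%:R) measurableT) iX.
  exact: measurable_boolR.
exists 1; split => // x x1 t _ /=; apply: le_trans (ltW x1).
by rewrite normr_nat; case: (b t).
Qed.

Lemma integrable_cst (c : R) : P.-integrable setT (EFin \o (fun=> c)).
Proof. exact: finite_measure_integrable_cst. Qed.

Lemma integrableRD (X Y : T -> R) : P.-integrable setT (EFin \o X) ->
  P.-integrable setT (EFin \o Y) ->
  P.-integrable setT (EFin \o (fun t => X t + Y t)).
Proof. by move=> iX iY; have := integrableD measurableT iX iY; apply. Qed.

Lemma integrableRB (X Y : T -> R) : P.-integrable setT (EFin \o X) ->
  P.-integrable setT (EFin \o Y) ->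
  P.-integrable setT (EFin \o (fun t => X t - Y t)).
Proof. by move=> iX iY; have := integrableB measurableT iX iY; apply. Qed.

(** [F (V t) t] is the shape of Y_{d,M_{d',z}}: a potential variable at a random index. The
    expansion reduces it to variables with fixed index. *)
Lemma select_bool (F : bool -> T -> R) (V : T -> bool) t :
  F (V t) t = (V t == true)%:R * F true t + (V t == false)%:R * F false t.
Proof. by case: (V t) => /=; rewrite mul1r mul0r ?addr0 ?add0r. Qed.

Lemma integrable_select (F : bool -> T -> R) (V : T -> bool) :
  measurable_fun setT V -> (forall m, P.-integrable setT (EFin \o F m)) ->
  P.-integrable setT (EFin \o (fun t => F (V t) t)).
Proof.
move=> mV iF; under [X in EFin \o X]eq_fun do rewrite select_bool.
by apply: integrableRD; apply: integrable_boolM => //; exact: measurable_eqb.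
Qed.

Lemma Rintegral_split_bool (W : T -> bool) (X : T -> R) :
  measurable_fun setT W -> P.-integrable setT (EFin \o X) ->
  \int[P]_t X t = \int[P]_t ((W t == true)%:R * X t)
                  + \int[P]_t ((W t == false)%:R * X t).
Proof.
move=> mW iX; rewrite -RintegralD//;
  try by apply: integrable_boolM => //; exact: measurable_eqb.
apply: eq_Rintegral => t _.
by case: (W t) => /=; rewrite mul1r mul0r ?addr0 ?add0r.
Qed.

Lemma Rintegral_almost_sure (b : T -> bool) (X Y : T -> R) :
  measurable_fun setT b -> pr P [set t | b t] = 1 ->
  P.-integrable setT (EFin \o X) -> P.-integrable setT (EFin \o Y) ->
  (forall t, b t -> X t = Y t) -> \int[P]_t X t = \int[P]_t Y t.
Proof.
move=> mb b1 iX iY XY; congr fine.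
have mB : measurable [set t | b t] by exact: (measurable_bool_set true).
apply: ae_eq_integral => //.
- exact: measurable_int iX.
- exact: measurable_int iY.
exists (~` [set t | b t]); split; first exact: measurableC.
  rewrite [LHS]probability_setC//.
  have -> : P [set t | b t] = 1%:E.
    by rewrite -b1 /pr fineK// fin_num_measure.
  by rewrite subee.
move=> t /= nXY bt; apply: nXY => _; congr EFin; exact: XY.
Qed.

(** Mean independence with the division by the probability of W = w undone, which positivity of that
    probability permits. *)
Lemma mean_indepE (Y : T -> R) (K : Type) (V : T -> K) (W : T -> bool)
    (f : K -> R) (w : bool) :
  mean_indep P Y V W -> 0 < pr P [set t | W t = w] ->
  \int[P]_t ((W t == w)%:R * (Y t * f (V t))) =
  pr P [set t | W t = w] * \int[P]_t (Y t * f (V t)).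
Proof.
move=> YVW w0; have [_] := YVW f w; rewrite /cond_mean meanE => <-.
rewrite mulrC divfK ?gt_eqF// eq_bool_set.
by rewrite Rintegral_bool_set.
Qed.

(** The first clause of [mean_indep] ranges over all functions of V, among them c * f. *)
Lemma mean_indep_cst (Y : T -> R) (K : Type) (V : T -> K) (W : T -> bool)
    (c : R) :
  mean_indep P Y V W -> mean_indep P (fun=> c) V W.
Proof.
move=> YVW f w; split; first exact: (proj1 (YVW f w)).
exact: (proj1 (YVW (fun k => c * f k) w)).
Qed.

(** The integrand is a sum over m of F m times an indicator that depends on V alone, and mean
    independence covers exactly such products. The event [b] allows a condition on D to be carried
    along when V contains D. *)
Lemma mean_indep_select (F : bool -> T -> R) (K : Type) (V : T -> K)
    (W : T -> bool) (h b : K -> bool) (w : bool) :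
  measurable_fun setT (h \o V) -> measurable_fun setT (b \o V) ->
  measurable_fun setT W -> (forall m, P.-integrable setT (EFin \o F m)) ->
  (forall m, mean_indep P (F m) V W) -> 0 < pr P [set t | W t = w] ->
  \int[P]_t ((W t == w)%:R * ((b (V t))%:R * F (h (V t)) t)) =
  pr P [set t | W t = w] * \int[P]_t ((b (V t))%:R * F (h (V t)) t).
Proof.
move=> mh mb mW iF FVW w0.
have mhm m : measurable_fun setT (fun t => b (V t) && (h (V t) == m)).
  by apply: measurable_and => //; exact: measurable_eqb.
pose G m t := F m t * (b (V t) && (h (V t) == m))%:R.
have iG m : P.-integrable setT (EFin \o G m).
  rewrite /G; under [X in EFin \o X]eq_fun do rewrite mulrC.
  exact: integrable_boolM.
have GE t : (b (V t))%:R * F (h (V t)) t = G true t + G false t.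
  by rewrite /G; case: (b _); case: (h _);
     rewrite /= ?(mul1r, mul0r, mulr1, mulr0, addr0, add0r).
under eq_Rintegral do rewrite GE mulrDr.
rewrite RintegralD//; try by apply: integrable_boolM => //; exact: measurable_eqb.
under [in RHS]eq_Rintegral do rewrite GE.
rewrite RintegralD// mulrDr.
rewrite (mean_indepE (fun k => (b k && (h k == true))%:R) (FVW true))//.
by rewrite (mean_indepE (fun k => (b k && (h k == false))%:R) (FVW false)).
Qed.

(** Where V0 <= V1, the selected values can differ only if V0 = 0 and V1 = 1, and then by F 1 - F 0;
    the complement is a null set. *)
Lemma Rintegral_select_mono (F : bool -> T -> R) (V1 V0 : T -> bool) :
  measurable_fun setT V1 -> measurable_fun setT V0 ->
  (forall m, P.-integrable setT (EFin \o F m)) ->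
  pr P [set t | (V0 t <= V1 t)%N] = 1 ->
  \int[P]_t F (V1 t) t - \int[P]_t F (V0 t) t =
  \int[P]_t ((V0 t < V1 t)%N%:R * (F true t - F false t)).
Proof.
move=> m1 m0 iF le1.
have mle : measurable_fun setT (fun t => (V0 t <= V1 t)%N).
  have -> : (fun t => (V0 t <= V1 t)%N) = (fun t => ~~ (V0 t && ~~ V1 t)).
    by apply/funext => t; case: (V0 t); case: (V1 t).
  by apply: measurable_neg; apply: measurable_and => //; exact: measurable_neg.
have mlt : measurable_fun setT (fun t => (V0 t < V1 t)%N).
  have -> : (fun t => (V0 t < V1 t)%N) = (fun t => ~~ V0 t && V1 t).
    by apply/funext => t; case: (V0 t); case: (V1 t).
  by apply: measurable_and => //; exact: measurable_neg.
rewrite -RintegralB//; try exact: integrable_select.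
apply: (Rintegral_almost_sure mle le1).
- by apply: integrableRB; exact: integrable_select.
- by apply: integrable_boolM => //; exact: integrableRB.
by move=> t; case: (V0 t); case: (V1 t) => //= _; rewrite ?mul1r ?mul0r ?subrr.
Qed.

End conditioning_on_booleans.

(** * Wald ratios as probability limits within a stratum of D *)

Section iv_probability_limits.
Context {d : measure_display} {T : measurableType d} {R : realType}.
Variables (P : probability T R) (D Z : T -> bool) (g : bool).
Hypotheses (mD : measurable_fun setT D) (mZ : measurable_fun setT Z).

Let p : R := pr P [set t | D t = g].
Let q (z : bool) : R := pr P [set t | Z t = z].
Hypotheses (p0 : 0 < p) (q0 : forall z, 0 < q z) (q1 : q true + q false = 1).

(* In the subsample D = g, the variable that equals [X z] when Z = z has
   conditional mean [A z] given Z = z. *)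
Definition stratum_means (X : bool -> T -> R) (A : bool -> R) :=
  (forall z, P.-integrable setT (EFin \o X z)) /\
  forall z, \int[P]_t ((D t == g)%:R * ((Z t == z)%:R * X z t)) = p * q z * A z.

(** On D = g the variable Y switches between X 1 and X 0 according to Z, and the weight Z keeps the
    first of them only. *)
Lemma stratum_moments (X : bool -> T -> R) (A : bool -> R) (Y : T -> R) :
  stratum_means X A -> (forall t, D t = g -> Y t = X (Z t) t) ->
  [/\ moments_exist D g P Y,
      moments_exist D g P (fun t => (Z t)%:R * Y t),
      \int[P]_t ((D t == g)%:R * Y t) =
        p * (q true * A true + q false * A false) &
      \int[P]_t ((D t == g)%:R * ((Z t)%:R * Y t)) = p * (q true * A true)].
Proof.
move=> [iX XA] YX.
have mDg : measurable_fun setT (fun t => D t == g) by exact: measurable_eqb.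
have mZz z : measurable_fun setT (fun t => Z t == z) by exact: measurable_eqb.
have iXz z : P.-integrable setT
    (EFin \o (fun t => (D t == g)%:R * ((Z t == z)%:R * X z t))).
  by do 2 apply: integrable_boolM => //.
have YE t : (D t == g)%:R * Y t =
    (D t == g)%:R * ((Z t == true)%:R * X true t)
    + (D t == g)%:R * ((Z t == false)%:R * X false t).
  case: eqP => [/YX ->|_]; last by rewrite !mul0r addr0.
  by rewrite !mul1r -select_bool.
have ZYE t : (D t == g)%:R * ((Z t)%:R * Y t) =
    (D t == g)%:R * ((Z t == true)%:R * X true t).
  rewrite mulrCA YE; case: (Z t) => /=;
    by rewrite ?(mul1r, mul0r, mulr0, addr0).
split.
- rewrite /moments_exist; under [X in EFin \o X]eq_fun do rewrite YE.
  exact: integrableRD.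
- by rewrite /moments_exist; under [X in EFin \o X]eq_fun do rewrite ZYE.
- under eq_Rintegral do rewrite YE.
  by rewrite RintegralD// !XA; ring.
- under eq_Rintegral do rewrite ZYE.
  by rewrite XA; ring.
Qed.

(** The limits are the coefficients of the line through the points (B z, A z) for z = 0, 1. The
    condition on the constant family says that D = g and Z = z have joint probability p * q z; it
    supplies the moments of 1 and of Z. *)
Lemma iv_stratum_limits (XY XM : bool -> T -> R) (A B : bool -> R)
    (Y X : T -> R) :
  stratum_means XY A -> (forall t, D t = g -> Y t = XY (Z t) t) ->
  stratum_means XM B -> (forall t, D t = g -> X t = XM (Z t) t) ->
  stratum_means (fun _ _ => 1) (fun=> 1) ->
  B true != B false ->
  consistent P
    (fun n (s : n.-tuple T) => (iv_coef D g Y X (fun t => (Z t)%:R) s).1)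
    ((A false * B true - B false * A true) / (B true - B false)) /\
  consistent P
    (fun n (s : n.-tuple T) => (iv_coef D g Y X (fun t => (Z t)%:R) s).2)
    ((A true - A false) / (B true - B false)).
Proof.
move=> SY YE SX XE S1 B10.
have [iY iZY EY EZY] := stratum_moments SY YE.
have [iX iZX EX EZX] := stratum_moments SX XE.
have [//|i1 iZ1 E1 EZ1] := @stratum_moments _ _ (cst 1) S1.
have iZ : moments_exist D g P (fun t => (Z t)%:R : R).
  by move: iZ1; rewrite /moments_exist; under eq_fun do rewrite mulr1.
have EZ : \int[P]_t ((D t == g)%:R * (Z t)%:R) = p * q true.
  by rewrite -[RHS]mulr1 -mulrA -EZ1; apply: eq_Rintegral => t _; rewrite mulr1.
have E1' : \int[P]_t ((D t == g)%:R * (cst 1 t : R)) = p.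
  by rewrite E1 !mulr1 q1 mulr1.
have qf : q false = 1 - q true by rewrite -q1 addrAC subrr add0r.
(* The factor p ^ 2 * q true * q false, where q true * q false is the variance of Z, also divides
   the numerators and cancels. *)
have detE : p * (p * (q true * B true))
    - p * q true * (p * (q true * B true + q false * B false)) =
    p ^+ 2 * q true * q false * (B true - B false).
  by rewrite qf; ring.
have qf0 : q false != 0 by rewrite gt_eqF.
have qt0 : q true != 0 by rewrite gt_eqF.
have pn0 : p != 0 by rewrite gt_eqF.
have Bn0 : B true - B false != 0 by rewrite subr_eq0.
have det0 : p ^+ 2 * q true * q false * (B true - B false) != 0.
  by rewrite !mulf_neq0// expf_neq0.
have := iv_coef_consistent i1 iY iX iZ iZX iZY.
rewrite EY EX EZ EZX EZY E1' detE => /(_ det0)[c1 c2].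
have slopeE : p * (p * (q true * A true)) -
    p * q true * (p * (q true * A true + q false * A false)) =
    p ^+ 2 * q true * q false * (A true - A false).
  by rewrite qf; ring.
split; [move: c1|move: c2; rewrite slopeE];
  set l := (X in consistent _ _ X -> _);
  set l' := (X in _ -> consistent _ _ X);
  suff -> : l = l' by [];
  by rewrite /l /l'; field; rewrite ?(Bn0, qf0, qt0, pn0).
Qed.

End iv_probability_limits.

(** * Identification of the two effects *)

Section identification.
Context {d : measure_display} {T : measurableType d} {R : realType}.
Variables (P : probability T R) (mod : mediation_model P).
Hypothesis H : assumptions mod.

Let D : T -> bool := D_ mod.
Let Z : T -> bool := Z_ mod.
Let M (d z : bool) : T -> bool := Mpot mod d z.
Let p (g : bool) : R := pr P [set t | D t = g].
Let q (z : bool) : R := pr P [set t | Z t = z].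

Let mD : measurable_fun setT D. Proof. exact: measurable_funP. Qed.
Let mZ : measurable_fun setT Z. Proof. exact: measurable_funP. Qed.
Let mM g z : measurable_fun setT (M g z). Proof. exact: measurable_funP. Qed.

Let p0 g : 0 < p g. Proof. exact: wd_treatment (as_well_defined H) g. Qed.
Let q0 z : 0 < q z. Proof. exact: wd_instrument (as_well_defined H) z. Qed.

Let iY g m : P.-integrable setT (EFin \o Ypot mod g m).
Proof. exact: wd_integrable (as_well_defined H) g m. Qed.

(* The outcomes Y_{0,m}, the mediator value m itself and the constant 1 are
   all families to which exogeneity and randomization apply. *)
Definition exogenous_family (F : bool -> T -> R) :=
  [/\ forall m, P.-integrable setT (EFin \o F m),
      forall g z m, mean_indep P (F m) (M g z) D &
      forall g z m, mean_indep P (F m) (fun t => (M g z t, D t)) Z].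

Lemma exogenous_outcome g : exogenous_family (Ypot mod g).
Proof.
by split=> [m|g' z m|g' z m]; [exact: iY|exact: (as_exogeneity H)|
  exact: (as_randomization H)].
Qed.

Lemma exogenous_cst (c : bool -> R) : exogenous_family (fun m _ => c m).
Proof.
split=> [m|g z m|g z m]; first exact: integrable_cst.
- exact: mean_indep_cst (as_exogeneity H true g true z).
- exact: mean_indep_cst (as_randomization H true g true z).
Qed.

Lemma instrument_probability_sum : q true + q false = 1.
Proof.
rewrite /q !pr_eq_Rintegral//.
transitivity (\int[P]_t (1 : R)); last first.
  by rewrite Rintegral_cst// mul1r [X in fine X]probability_setT.
rewrite [RHS](Rintegral_split_bool mZ); last exact: integrable_cst.
by congr (_ + _); apply: eq_Rintegral => t _; rewrite mulr1.
Qed.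

Lemma exogenous_randomized F g z : exogenous_family F ->
  \int[P]_t ((Z t == z)%:R * F (M g z t) t) =
  q z * \int[P]_t F (M g z t) t.
Proof.
move=> [iF _ Fr].
have := @mean_indep_select _ _ _ P F _ (fun t => (M g z t, D t)) Z fst
  (fun=> true) z.
move=> /(_ (mM g z) (measurable_cst _) mZ iF (Fr g z) (q0 z)) /=.
under eq_Rintegral do rewrite mulr1n mul1r.
by under [in RHS]eq_Rintegral do rewrite mulr1n mul1r.
Qed.

(** Randomization is joint in (M_{g,z}, D), so the event D = g is carried along while Z is factored
    out; exogeneity then factors out D. *)
Lemma exogenous_stratum F g : exogenous_family F ->
  stratum_means P D Z g (fun z t => F (M g z t) t)
    (fun z => \int[P]_t F (M g z t) t).
Proof.
move=> [iF Fx Fr]; split=> z; first exact: integrable_select.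
under eq_Rintegral do rewrite mulrCA.
have mDg : measurable_fun setT (fun t => D t == g) by exact: measurable_eqb.
rewrite (@mean_indep_select _ _ _ P F _ (fun t => (M g z t, D t)) Z fst
  (fun k => k.2 == g) z (mM g z) mDg mZ iF (Fr g z) (q0 z)).
have := @mean_indep_select _ _ _ P F _ (M g z) D id (fun=> true) g.
move=> /(_ (mM g z) (measurable_cst _) mD iF (Fx g z) (p0 g)) /=.
under eq_Rintegral do rewrite mulr1n mul1r.
under [in RHS]eq_Rintegral do rewrite mulr1n mul1r.
by move=> ->; rewrite mulrA [p g * q z]mulrC.
Qed.

Lemma exogenous_instrument_mixture F g : exogenous_family F ->
  \int[P]_t F (M g (Z t) t) t =
  q true * \int[P]_t F (M g true t) t + q false * \int[P]_t F (M g false t) t.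
Proof.
move=> EF; have [iF _ _] := EF.
have iFM z : P.-integrable setT (EFin \o (fun t => F (M g z t) t)).
  exact: integrable_select.
rewrite (Rintegral_split_bool mZ); last first.
  exact: (@integrable_select _ _ _ P (fun z t => F (M g z t) t)).
rewrite -!exogenous_randomized//.
by congr (_ + _); apply: eq_Rintegral => t _; case: (Z t) => //=; rewrite !mul0r.
Qed.

(** Used with V1, V0 = M_{1z}, M_{0z} for those who respond to D, and with M_{01}, M_{00} for those
    who respond to Z. The product form remains valid when nobody responds. *)
Lemma cond_mean_responders (V1 V0 : T -> bool) :
  measurable_fun setT V1 -> measurable_fun setT V0 ->
  pr P [set t | (V0 t <= V1 t)%N] = 1 ->
  let C := [set t | (V0 t < V1 t)%N] in
  \int[P]_t Ypot mod false (V1 t) t - \int[P]_t Ypot mod false (V0 t) t =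
    cond_mean P (fun t => Ypot mod false true t - Ypot mod false false t) C
    * pr P C
  /\ \int[P]_t (V1 t)%:R - \int[P]_t (V0 t)%:R = pr P C.
Proof.
move=> m1 m0 le1 C.
have mlt : measurable_fun setT (fun t => (V0 t < V1 t)%N).
  have -> : (fun t => (V0 t < V1 t)%N) = (fun t => ~~ V0 t && V1 t).
    by apply/funext => t; case: (V0 t); case: (V1 t).
  by apply: measurable_and => //; exact: measurable_neg.
split.
  rewrite (@Rintegral_select_mono _ _ _ P (Ypot mod false) _ _ m1 m0)//.
  rewrite -Rintegral_bool_set /cond_mean.
  (* If C is null the right side is 0, and so is the integral over C. *)
  have [pC0|pC0] := eqVneq (pr P C) 0; last by rewrite divfK.
  rewrite pC0 mulr0.
  have mC : measurable C by exact: (measurable_bool_set true).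
  have PC : P C = 0%E.
    by apply/eqP; rewrite -fine_eq0 ?fin_num_measure//; apply/eqP.
  rewrite /Rintegral null_set_integral//.
  by apply: measurable_int; apply: integrableS (integrableRB _ _) => //.
rewrite (@Rintegral_select_mono _ _ _ P (fun m _ => m%:R) _ _ m1 m0)//.
  2: by move=> m; exact: integrable_cst.
rewrite /C pr_Rintegral//; apply: eq_Rintegral => t _.
by rewrite subr0 mulr1.
Qed.

Lemma NIE0_formula : NIE0 mod = \sum_(z : bool)
  cond_mean P (fun t => Ypot mod false true t - Ypot mod false false t)
    [set t | (Mpot mod true z t > Mpot mod false z t)%N]
  * pr P [set t | (Mpot mod true z t > Mpot mod false z t)%N]
  * pr P [set t | Z_ mod t = z].
Proof.
have iYM g : P.-integrable setT
    (EFin \o (fun t => Ypot mod false (M g (Z t) t) t)).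
  apply: (@integrable_select _ _ _ P (fun z t => Ypot mod false (M g z t) t)).
    exact: mZ.
  by move=> z; exact: (@integrable_select _ _ _ P (Ypot mod false)).
rewrite /NIE0 meanE RintegralB//; try exact: iYM.
have EY := exogenous_outcome false.
rewrite (exogenous_instrument_mixture true EY).
rewrite (exogenous_instrument_mixture false EY) big_bool /=.
have [<- _] := cond_mean_responders (mM true true) (mM false true)
  (as_monotone_in_D H true).
have [<- _] := cond_mean_responders (mM true false) (mM false false)
  (as_monotone_in_D H false).
by rewrite -/(q true) -/(q false); ring.
Qed.

Lemma NIE0_IV_formula : NIE0_IV mod =
  cond_mean P (fun t => Ypot mod false true t - Ypot mod false false t)
    [set t | (Mpot mod false true t > Mpot mod false false t)%N]
  * \sum_(z : bool)
      pr P [set t | (Mpot mod true z t > Mpot mod false z t)%N]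
      * pr P [set t | Z_ mod t = z].
Proof.
pose N g z : R := \int[P]_t (M g z t)%:R.
pose A z : R := \int[P]_t Ypot mod false (M false z t) t.
have SY := exogenous_stratum false (exogenous_outcome false).
have SM g : stratum_means P D Z g (fun z t => (M g z t)%:R) (N g).
  exact: (exogenous_stratum g (exogenous_cst (fun m => m%:R))).
have S1 g : stratum_means P D Z g (fun _ _ => 1) (fun=> 1).
  split=> [z|z]; first exact: integrable_cst.
  have [_ S1] := exogenous_stratum g (exogenous_cst (fun=> 1)).
  rewrite S1; congr (_ * _).
  by rewrite Rintegral_cst// mul1r [X in fine X]probability_setT.
(* In the regression of M on Z, the regressor is the instrument itself, with stratum mean z. *)
have SZ g : stratum_means P D Z g (fun z _ => z%:R) (fun z => z%:R).
  split=> [z|[]]; [exact: integrable_cst|exact: (S1 g).2 true|].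
  under eq_Rintegral do rewrite !mulr0.
  by rewrite Rintegral_cst// mul0r mulr0.
have q1 := instrument_probability_sum.
have Mobs_eq g t : D t = g -> (Mobs mod t)%:R = (M g (Z t) t)%:R :> R.
  by rewrite /Mobs -/D => ->.
have Yobs_eq t : D t = false ->
    Yobs mod t = Ypot mod false (M false (Z t) t) t.
  by rewrite /Yobs /Mobs -/D => ->.
have [compA compN] := cond_mean_responders (mM false true) (mM false false)
  (as_monotone_in_Z H false).
have comp0 := wd_compliers (as_well_defined H).
(* The first stage in the stratum D = 0 equals the probability of M_{01} > M_{00}. *)
have N0 : N false true != N false false.
  by rewrite -subr_eq0 compN gt_eqF.
have [_ beta] := iv_stratum_limits mD mZ (p0 false) q0 q1 SY Yobs_eq
  (SM false) (Mobs_eq false) (S1 false) N0.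
have z10 : true%:R != false%:R :> R by rewrite oner_eq0.
have [pi0 pi1] := iv_stratum_limits mD mZ (p0 true) q0 q1 (SM true)
  (Mobs_eq true) (SZ true) (X := fun t => (Z t)%:R) (fun _ _ => erefl)
  (S1 true) z10.
have [tau0 tau1] := iv_stratum_limits mD mZ (p0 false) q0 q1 (SM false)
  (Mobs_eq false) (SZ false) (X := fun t => (Z t)%:R) (fun _ _ => erefl)
  (S1 false) z10.
rewrite /NIE0_IV /beta1_IV /pi0_IV /pi1_IV /tau0_IV /tau1_IV.
rewrite (consistent_plim beta) (consistent_plim pi0) (consistent_plim pi1).
rewrite (consistent_plim tau0) (consistent_plim tau1).
have -> : mean P (fun t => (Z_ mod t)%:R) = q true.
  by rewrite meanE -pr_Rintegral.
(* The probability of M_{01} > M_{00} cancels in beta_1. There remains the average over Z of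
   E[M_{1z}] - E[M_{0z}]. *)
rewrite compA compN mulfK ?gt_eqF//; congr (_ * _).
rewrite big_bool /=.
have [_ <-] := cond_mean_responders (mM true true) (mM false true)
  (as_monotone_in_D H true).
have [_ <-] := cond_mean_responders (mM true false) (mM false false)
  (as_monotone_in_D H false).
rewrite -compN -/(q true) -/(q false) -/(N true true) -/(N true false).
rewrite -/(N false true) -/(N false false).
have -> : q false = 1 - q true by rewrite -q1 addrAC subrr add0r.
by field.
Qed.

End identification.

(** * The uniform law on eight points *)

Section uniform8.
Context {R : realType}.

Let eighth_ge0 : 0 <= 8^-1 :> R. Proof. by rewrite invr_ge0. Qed.

Definition uniform8 : set nat -> \bar R :=
  mscale (NngNum eighth_ge0) (msum (fun i => @dirac _ nat i R) 8).

HB.instance Definition _ := Measure.on uniform8.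

Lemma uniform8_setT : uniform8 setT = 1%E.
Proof.
transitivity ((8^-1)%:E * \sum_(i < 8) @dirac _ nat i R setT)%E; first by [].
under eq_bigr do rewrite diracT.
by rewrite sumEFin sumr_const card_ord -EFinM mulVf.
Qed.

HB.instance Definition _ :=
  Measure_isProbability.Build _ _ _ uniform8 uniform8_setT.

Lemma ge0_integral_uniform8 (X : nat -> R) : (forall i, 0 <= X i) ->
  (\int[uniform8]_i (X i)%:E = (8^-1 * \sum_(i < 8) X i)%:E)%E.
Proof.
move=> X0; have X0' i : (0 <= (X i)%:E)%E by rewrite lee_fin.
rewrite /uniform8 ge0_integral_mscale//.
rewrite ge0_integral_measure_sum//= EFinM -sumEFin; congr (_ * _)%E.
by apply: eq_bigr => i _; rewrite integral_dirac// diracT mul1e.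
Qed.

Lemma Rintegral_uniform8 (X : nat -> R) :
  \int[uniform8]_i X i = 8^-1 * \sum_(i < 8) X i.
Proof.
rewrite /Rintegral integralE.
rewrite -!/(EFin \o X) funerpos funerneg.
rewrite (ge0_integral_uniform8 (fun i => funrpos_ge0 X i)).
rewrite (ge0_integral_uniform8 (fun i => funrneg_ge0 X i)).
rewrite -EFinB /= -mulrBr -sumrB; congr (_ * _); apply: eq_bigr => i _.
by rewrite -[in RHS](funrposBneg X).
Qed.

End uniform8.

(** * A model in which the two quantities differ *)

Section counterexample.
Context {R : realType}.

Let P : probability nat R := uniform8.

(** A named identity, to which the instance below attaches measurability for an arbitrary function
    on the discrete space nat. *)
Definition nat_fun {d} {U : measurableType d} (f : nat -> U) : nat -> U := f.

Lemma measurable_nat_fun d (U : measurableType d) (f : nat -> U) :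
  measurable_fun setT (nat_fun f).
Proof. by []. Qed.

HB.instance Definition _ d (U : measurableType d) (f : nat -> U) :=
  isMeasurableFun.Build _ _ nat U (nat_fun f) (measurable_nat_fun f).

(* The three lowest bits of [i] are D, Z and the type of the individual. Those
   of type 1 have M = Z and Y = M, the others have M = D and Y = 0. *)
Let bit (k i : nat) : bool := odd (i %/ 2 ^ k).
Let exM (g z : bool) (i : nat) : bool := if bit 2 i then z else g.
Let exY (m : bool) (i : nat) : R := (bit 2 i && m)%:R.

Definition counterexample : mediation_model P := @MediationModel _ _ _ P
  (nat_fun (bit 0)) (nat_fun (bit 1)) (fun g z => nat_fun (exM g z))
  (fun _ m => nat_fun (exY m)) (fun _ m _ => nat_fun (exY m)).

Lemma mean_uniform8 (X : nat -> R) : \int[P]_i X i = 8^-1 *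
  (X 0%N + X 1%N + X 2%N + X 3%N + X 4%N + X 5%N + X 6%N + X 7%N).
Proof.
rewrite Rintegral_uniform8; congr (_ * _).
by rewrite !big_ord_recl big_ord0 /= addr0 !addrA.
Qed.

Lemma pr_uniform8 (b : nat -> bool) : pr P [set i | b i] = 8^-1 *
  ((b 0%N)%:R + (b 1%N)%:R + (b 2%N)%:R + (b 3%N)%:R
   + (b 4%N)%:R + (b 5%N)%:R + (b 6%N)%:R + (b 7%N)%:R).
Proof. by rewrite pr_Rintegral// mean_uniform8. Qed.

Lemma mean_indep_uniform8 (Y : nat -> R) (K : Type) (V : nat -> K)
    (W : nat -> bool) :
  (forall w, pr P [set i | W i = w] = 2^-1) ->
  (forall (f : K -> R) w, \int[P]_i ((W i == w)%:R * f (V i)) =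
    2^-1 * \int[P]_i f (V i)) ->
  (forall (f : K -> R) w, \int[P]_i ((W i == w)%:R * (Y i * f (V i))) =
    2^-1 * \int[P]_i (Y i * f (V i))) ->
  mean_indep P Y V W.
Proof.
move=> W2 EV EYV f w; rewrite /cond_mean W2 !meanE eq_bool_set.
by rewrite !Rintegral_bool_set EV EYV; split; field.
Qed.

Lemma pr_bit k w : (k < 3)%N -> pr P [set i | bit k i = w] = 2^-1.
Proof.
rewrite eq_bool_set pr_uniform8.
by case: k => [|[|[|]]]//; case: w; rewrite /bit /= => _; field.
Qed.

Lemma counterexample_assumptions : assumptions counterexample.
Proof.
split.
- split.
  + move=> g m; apply: measurable_bounded_integrable => //.
      by rewrite [X in (X < _)%E]probability_setT ltry.
    exists 1; split => // x x1 t _ /=; apply: le_trans (ltW x1).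
    by rewrite normr_nat; case: (_ && _).
  + by move=> w; rewrite (pr_bit (k := 0))// invr_gt0.
  + by move=> w; rewrite (pr_bit (k := 1))// invr_gt0.
  + by rewrite pr_uniform8 /= /nat_fun /exM /bit /=; lra.
(* The potential variables depend on the type bit only, and the D bit is fair given it. For
   randomization, the Z bit is fair given type and D. *)
- move=> g0 g m z; apply: mean_indep_uniform8 => [w|f w|f w].
  + exact: (pr_bit (k := 0)).
  + rewrite !mean_uniform8 /= /nat_fun /exM /bit /=.
    by case: w; rewrite /=; lra.
  + rewrite !mean_uniform8 /= /nat_fun /exM /exY /bit /=.
    by case: w; rewrite /=; lra.
- move=> g0 g m z; apply: mean_indep_uniform8 => [w|f w|f w].
  + exact: (pr_bit (k := 1)).
  + rewrite !mean_uniform8 /= /nat_fun /exM /bit /=.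
    by case: w; rewrite /=; lra.
  + rewrite !mean_uniform8 /= /nat_fun /exM /exY /bit /=.
    by case: w; rewrite /=; lra.
- by [].
(* The conditional probabilities of M = 1 are 3/4 for Z = 1 and 1/4 for Z = 0. *)
- rewrite /iv_relevance /cond_pr.
  have -> : [set t | Mobs counterexample t = true] =
    [set t | Mobs counterexample t] by [].
  rewrite !(pr_bit (k := 1))//.
  have prI z : pr P ([set i | Mobs counterexample i] `&` [set i | bit 1 i = z])
    = pr P [set i | Mobs counterexample i && (bit 1 i == z)].
    congr pr; apply/seteqP.
    by split=> [i /= [-> ->]|i /= /andP[-> /eqP]]; rewrite ?eqxx.
  rewrite !prI !pr_uniform8 /Mobs /= /nat_fun /exM /bit /=.
  by move=> /eqP; apply/negP; rewrite -subr_eq0; apply/eqP; lra.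
- move=> z; rewrite pr_uniform8 /= /nat_fun /exM /bit /=.
  by case: z; rewrite /=; lra.
- move=> z; rewrite pr_uniform8 /= /nat_fun /exM /bit /=.
  by case: z; rewrite /=; lra.
Qed.

(** Type 1 responds to Z and has effect 1, type 0 responds to D and has effect 0. Hence [NIE0] is 0,
    whereas [NIE0_IV] is 1 times the probability 1/2 of type 0. *)
Lemma counterexample_NIE0_IV : NIE0_IV counterexample <> NIE0 counterexample.
Proof.
rewrite (NIE0_IV_formula counterexample_assumptions).
rewrite (NIE0_formula counterexample_assumptions) !big_bool /=.
rewrite !(pr_bit (k := 1))// /cond_mean !Rintegral_bool_set.
rewrite !pr_uniform8 !mean_uniform8 /= /nat_fun /exM /exY /bit /=.
have -> : 8^-1 * (0 + 0 + 0 + 0 + 1 + 1 + 1 + 1) = 2^-1 :> R by field.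
have -> : 8^-1 * (1 + 1 + 1 + 1 + 0 + 0 + 0 + 0) = 2^-1 :> R by field.
by rewrite invrK; lra.
Qed.

End counterexample.

Theorem mainTheorem3 (R : realType) :
  (forall (disp : measure_display) (T : measurableType disp)
      (P : probability T R) (mod : mediation_model P),
    assumptions mod ->
    NIE0 mod =
      \sum_(z : bool)
        cond_mean P (fun t => Ypot mod false true t - Ypot mod false false t)
          [set t | (Mpot mod true z t > Mpot mod false z t)%N]
        * pr P [set t | (Mpot mod true z t > Mpot mod false z t)%N]
        * pr P [set t | Z_ mod t = z]
    /\
    NIE0_IV mod =
      cond_mean P (fun t => Ypot mod false true t - Ypot mod false false t)
        [set t | (Mpot mod false true t > Mpot mod false false t)%N]
      * \sum_(z : bool)
          pr P [set t | (Mpot mod true z t > Mpot mod false z t)%N]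
          * pr P [set t | Z_ mod t = z])
  /\
  (exists (disp : measure_display) (T : measurableType disp)
      (P : probability T R) (mod : mediation_model P),
    assumptions mod /\ NIE0_IV mod <> NIE0 mod).
Proof.
split=> [disp T P mod H|].
  by split; [exact: NIE0_formula|exact: NIE0_IV_formula].
exists _, nat, uniform8, counterexample.
by split; [exact: counterexample_assumptions|exact: counterexample_NIE0_IV].
Qed.
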